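(* Let $b>1$ be an integer and let $A\subset\{0,1,\dots,b-1\}$ contain at least one non-zero element; let $N=\#A$, $f=\max A$ and $\lambda=f/(b-1)$. Let $\alpha(s)$ be the entire function $\alpha(s)=\prod_{n=0}^\infty(1-b^{-s-n}N)$, and let $(u_m(s))_{m\ge0}$ be the sequence of meromorphic functions on $\mathbb{C}$ defined in the context. Then, uniformly on every compact subset of the complex plane, $$\alpha(s)\,\frac{(s)_m}{m!}\,u_m(s) = O\bigl(\lambda^m m^{-1}\bigr)\qquad (m\to\infty).$$ That is, for every compact $Q\subset\mathbb{C}$ there are a constant $M$ and an integer $m_0\ge 1$ such that $\bigl|\alpha(s)\frac{(s)_m}{m!}u_m(s)\bigr|\le M\lambda^m m^{-1}$ for all $s\in Q$ and all $m\ge m_0$.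
   Context: $(s)_m=s(s+1)\cdots(s+m-1)$ is the Pochhammer symbol, with $(s)_0=1$. Put $\gamma_j=\sum_{a\in A}a^j$. The meromorphic functions $u_m(s)$ on $\mathbb{C}$ are defined by $u_0(s)=\dfrac{b^s}{b^s-N}$ and, for $m\ge1$, by the recurrence $$(b^{s+m}-N)\,u_m(s)=\sum_{j=1}^m\binom{m}{j}\gamma_j\,u_{m-j}(s).$$ (For $\Re s>\log_b N$ one has $u_m(s)=0^m+\sum_{l\ge1}\sum_{(a_1,\dots,a_l)\in A^l}(a_1b^{-1}+\dots+a_lb^{-l})^m b^{-ls}$, with $0^0=1$.) The function $u_m$ has at most simple poles, located at zeros of $b^{s+j}-N$, $0\le j\le m$, so the products $\alpha(s)u_m(s)$ are entire functions; at poles of $u_m$ the product is understood as the value of this entire function. *)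

(* Defs.v *)
(* MathComp and MathComp-Analysis. *)
From HB Require Import structures.
From mathcomp Require Import all_boot all_order all_algebra.
From mathcomp Require Import all_classical all_reals all_analysis.
From mathcomp.real_closed Require Import complex.

Set Implicit Arguments.
Unset Strict Implicit.
Unset Printing Implicit Defensive.

Import Order.TTheory GRing.Theory Num.Theory.
Import numFieldNormedType.Exports.

Local Open Scope classical_set_scope.
Local Open Scope ring_scope.
Local Open Scope complex_scope.

(* The bare type R[i] carries no topology; its packed form below inherits the
   one that MathComp-Analysis puts on every numeric field (that of the norm). *)
Definition Cpx (R : realType) : numClosedFieldType := R[i].

(* Principal value: a^(x + iy) = a^x (cos (y ln a) + i sin (y ln a)), a > 0. *)
Definition rpowC (R : realType) (a : R) (s : Cpx R) : Cpx R :=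
  (a `^ complex.Re s * cos (complex.Im s * ln a)) +i*
  (a `^ complex.Re s * sin (complex.Im s * ln a)).

Definition pochhammer (R : realType) (s : Cpx R) (m : nat) : Cpx R :=
  \prod_(i < m) (s + i%:R).

Definition gamma (b : nat) (A : {set 'I_b}) (j : nat) : nat :=
  (\sum_(a in A) a ^ j)%N.

Definition max_digit (b : nat) (A : {set 'I_b}) : nat :=
  (\max_(a in A) a)%N.

Definition lambda (R : realType) (b : nat) (A : {set 'I_b}) : R :=
  (max_digit A)%:R / (b%:R - 1).

Definition alpha (R : realType) (b : nat) (A : {set 'I_b}) (s : Cpx R) : Cpx R :=
  limn (fun k : nat =>
    \prod_(0 <= n < k) (1 - rpowC b%:R (- s - n%:R) * #|A|%:R) : Cpx R).

(* [:: u_0(s); ...; u_m(s)]. *)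
Fixpoint u_seq (R : realType) (b : nat) (A : {set 'I_b}) (s : Cpx R) (m : nat)
    : seq (Cpx R) :=
  if m is k.+1 then
    let us := u_seq A s k in
    rcons us
      ((\sum_(1 <= j < m.+1) 'C(m, j)%:R * (gamma A j)%:R * us`_(m - j))
       / (rpowC b%:R (s + m%:R) - #|A|%:R))
  else [:: rpowC b%:R s / (rpowC b%:R s - #|A|%:R)].

(* The values where rpowC b (s + j) = #|A| for some j <= m are meaningless
   (division by zero); elsewhere u A m is the meromorphic function u_m. *)
Definition u (R : realType) (b : nat) (A : {set 'I_b}) (m : nat) (s : Cpx R)
    : Cpx R := (u_seq A s m)`_m.

(* The entire function alpha * u_m. Its value at s is the limit over z -> s,
   z != s: the exceptional points of u are isolated, so they play no role, and
   at a pole of u_m this is the value of the analytic continuation. *)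
Definition alpha_u (R : realType) (b : nat) (A : {set 'I_b}) (m : nat)
    (s : Cpx R) : Cpx R :=
  lim ((alpha A z * u A m z : Cpx R) @[z --> s^']).

Lemma size_u_seq (R : realType) (b : nat) (A : {set 'I_b}) (s : Cpx R) m :
  size (u_seq A s m) = m.+1.
Proof. by elim: m => //= m IH; rewrite size_rcons IH. Qed.

Lemma nth_u_seq (R : realType) (b : nat) (A : {set 'I_b}) (s : Cpx R) m i :
  (i <= m)%N -> (u_seq A s m)`_i = u A i s.
Proof.
elim: m => [|m IH]; first by case: i.
rewrite leq_eqVlt => /predU1P[->//|im].
by rewrite /= nth_rcons size_u_seq im IH.
Qed.

Lemma u0E (R : realType) (b : nat) (A : {set 'I_b}) (s : Cpx R) :
  u A 0 s = rpowC b%:R s / (rpowC b%:R s - #|A|%:R).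
Proof. by []. Qed.

Lemma u_rec (R : realType) (b : nat) (A : {set 'I_b}) (s : Cpx R) m :
  (0 < m)%N -> rpowC b%:R (s + m%:R) != #|A|%:R ->
  (rpowC b%:R (s + m%:R) - #|A|%:R) * u A m s =
  \sum_(1 <= j < m.+1) 'C(m, j)%:R * (gamma A j)%:R * u A (m - j) s.
Proof.
case: m => // m _ ne.
rewrite {1}/u /= nth_rcons size_u_seq ltnn eqxx mulrC divfK ?subr_eq0//.
apply: eq_big_nat => j /andP[j1 _]; rewrite nth_u_seq//.
by case: j j1 => // j _; rewrite subSS leq_subr.
Qed.

(* Main.v *)
Require Import Defs.
From HB Require Import structures.
From mathcomp Require Import all_boot all_order all_algebra.
From mathcomp Require Import all_classical all_reals all_analysis.
From mathcomp.real_closed Require Import complex.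
From mathcomp Require Import zify ring lra.

Set Implicit Arguments.
Unset Strict Implicit.
Unset Printing Implicit Defensive.

Import Order.TTheory GRing.Theory Num.Theory.
Import numFieldNormedType.Exports.

Local Open Scope classical_set_scope.
Local Open Scope ring_scope.
Local Open Scope complex_scope.

(** Put [sigma = Re s].  Multiplied by a partial product of [alpha], the
    sequence [u_m(s)] keeps its recurrence and is bounded, uniformly in [s], for
    the finitely many [m] below a threshold [n].  For [m >= n] it is dominated,
    by induction on [m], by
      lambda^m m! / ((sigma + n) ... (sigma + m)),
    which grows like [lambda^m m^(-sigma)] and is almost a supersolution of the
    recurrence: since [lambda (b - 1)] is the largest digit, that digit
    contributes
      sum_(j <= m - n) binom(sigma + m, j) (b - 1)^j <= b^(sigma + m),
    a truncated binomial series with nonnegative remainder, whereas the other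
    digits, the terms below [n], and the [N] in [b^(s + m) - N] only cost factors
    [1 + O(mu^m)] with [mu < 1], whose product converges.  Finally [(s)_m] is
    comparable to [(sigma + n) ... (sigma + m) / m].  Where some [b^(s + j)]
    equals [N], the partial products of [alpha] vanish. *)

(** * Truncated binomial series with real exponent *)

(** The Taylor polynomial at 0, of degree below [n], of [(1 + x)^p] for real [p]. *)
Definition binom_poly (R : realType) (p : R) (n : nat) : {poly R} :=
  \poly_(j < n) ((\prod_(i < j) (p - i%:R)) / j`!%:R).

Lemma deriv_binom_poly (R : realType) (p : R) n :
  (binom_poly p n.+1)^`() = p *: binom_poly (p - 1) n.
Proof.
apply/polyP => j; rewrite coef_deriv coefZ !coef_poly ltnS.
case: ifP => _; last by rewrite mul0rn mulr0.
rewrite big_ord_recl subr0 factS natrM -[LHS]mulr_natr.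
under eq_bigr => i _ do rewrite lift0 -[i.+1%:R]natr1 [i%:R + 1]addrC opprD addrA.
by field; rewrite addrC natr1 !pnatr_eq0 -lt0n fact_gt0.
Qed.

(* Lagrange's remainder of the binomial series is nonnegative when the series
   is truncated before the exponent. *)
Lemma binom_poly_le_powR (R : realType) n (p x : R) :
  n%:R <= p -> 0 <= x -> (binom_poly p n.+1).[x] <= (1 + x) `^ p.
Proof.
elim: n p x => [|n IH] p x np x0.
  rewrite horner_poly big_ord1 big_ord0 fact0 divr1 expr0 mulr1.
  by rewrite -[leLHS](powRr0 (1 + x)) ler_powR // lerDl.
have p0 : 0 <= p by apply: le_trans np.
(* [F] vanishes at 0, and its derivative is [p] times the same difference for [p - 1] and [n],
   nonnegative by induction. *)
pose df (y : R) := p * (1 + y) `^ (p - 1) - (binom_poly p n.+2)^`().[y].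
pose F (y : R) := (1 + y) `^ p - (binom_poly p n.+2).[y].
have dF (y : R) : 0 <= y -> is_derive y 1 F (df y).
  move=> y0; have y1 : 0 < 1 + y by lra.
  apply: is_deriveB.
  have H := is_derive1_powR p y1.
  have D : is_derive y 1 (fun z : R => 1 + z) 1.
    apply: (is_derive_eq (is_deriveD _ _)). exact: add0r.
  have := @is_derive1_comp _ (fun z : R => z `^ p) (fun z => 1 + z) y _ _ H D.
  by rewrite mulr1.
have cF : {within `[0, x], continuous F}.
  apply: derivable_within_continuous => y; rewrite in_itv /= => /andP[y0 _].
  by have [] := dF _ y0.
have [|c] := MVT_segment x0 _ cF (df := df).
  by move=> y; rewrite in_itv /= => /andP[/ltW /dF].
rewrite in_itv /= => /andP[c0 _] Fx.
have F0 : F 0 = 0.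
  rewrite /F addr0 powR1 horner_poly big_ord_recl big_ord0 fact0 divr1 mulr1.
  by rewrite big1 ?addr0 ?subrr // => i _; rewrite expr0n mulr0.
suff : 0 <= F x by rewrite subr_ge0.
move: Fx; rewrite F0 !subr0 => ->; apply: mulr_ge0 => //.
rewrite /df deriv_binom_poly hornerZ -mulrBr mulr_ge0 // subr_ge0 IH //.
by rewrite lerBrDr natr1.
Qed.

(** * Convergent products and the comparison weight *)

Lemma prod_geometric_le (R : realType) (C mu : R) m :
  0 <= C -> 0 <= mu < 1 ->
  \prod_(i < m) (1 + C * mu ^+ i) <= expR (C / (1 - mu)).
Proof.
move=> C0 /andP[mu0 mu1].
have d0 : 0 < 1 - mu by rewrite subr_gt0.
(* The partial geometric sum in the exponent makes the induction close, by [1 + t <= expR t]. *)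
suff : \prod_(i < m) (1 + C * mu ^+ i) <= expR (C / (1 - mu) * (1 - mu ^+ m)).
  move=> /le_trans; apply; rewrite ler_expR; apply: ler_piMr.
    by rewrite divr_ge0 // ltW.
  by rewrite gerBl exprn_ge0.
elim: m => [|m IH]; first by rewrite big_ord0 expr0 subrr mulr0 expR0.
rewrite big_ord_recr /=.
have -> : C / (1 - mu) * (1 - mu ^+ m.+1)
    = C / (1 - mu) * (1 - mu ^+ m) + C * mu ^+ m.
  by rewrite exprS; field; rewrite gt_eqF.
rewrite expRD ler_pM ?expR_ge1Dx //.
  by apply: prodr_ge0 => i _; rewrite addr_ge0 ?mulr_ge0 ?exprn_ge0.
by rewrite addr_ge0 ?mulr_ge0 ?exprn_ge0.
Qed.

(** For [m >= n] and up to a factor free of [m], this is Gamma(m + 1) / Gamma(sigma + m + 1);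
    starting the product at [n] keeps its factors positive once [sigma + n > 0]. *)
Definition weight (R : realType) (sigma : R) (n m : nat) : R :=
  m`!%:R / \prod_(n <= i < m.+1) (sigma + i%:R).

Lemma weight_gt0 (R : realType) (sigma : R) n m :
  0 < sigma + n%:R -> 0 < weight sigma n m.
Proof.
move=> sn; rewrite divr_gt0 ?ltr0n ?fact_gt0 // big_nat.
apply: prodr_gt0 => i /andP[ni _]; apply: lt_le_trans sn _.
by rewrite lerD2l ler_nat.
Qed.

(** The factorial [(m - j)!] cancels, and the factors lost between [m] and [m - j] form the falling
    factorial of [sigma + m]: the weight turns integer binomials into those of [sigma + m]. *)
Lemma bin_weight (R : realType) (sigma : R) n m j :
  0 < sigma + n%:R -> (j <= m - n)%N -> (n <= m)%N ->
  'C(m, m - j)%:R * weight sigma n (m - j) =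
  weight sigma n m * ((\prod_(i < j) (sigma + m%:R - i%:R)) / j`!%:R).
Proof.
move=> sn jmn nm; have jm : (j <= m)%N by lia.
have pos k l : (n <= k)%N -> 0 < \prod_(k <= i < l) (sigma + i%:R).
  move=> nk; rewrite big_nat; apply: prodr_gt0 => i /andP[ki _].
  by apply: lt_le_trans sn _; rewrite lerD2l ler_nat; lia.
have -> : \prod_(i < j) (sigma + m%:R - i%:R) =
    \prod_((m - j).+1 <= i < m.+1) (sigma + i%:R).
  rewrite big_rev_mkord subSS subKn //; apply: eq_bigr => i _.
  by rewrite subSS natrB ?addrA //; have := ltn_ord i; lia.
rewrite /weight.
rewrite [in RHS](@big_cat_nat _ _ _ (m - j).+1) /=; try lia.
have := bin_fact jm; rewrite -bin_sub // => /(congr1 (fun k => k%:R : R)).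
rewrite !natrM => <-.
have h1 := pos n (m - j).+1 (leqnn _).
have h2 : 0 < \prod_((m - j).+1 <= i < m.+1) (sigma + i%:R) by apply: pos; lia.
by field; rewrite !gt_eqF // ltr0n fact_gt0.
Qed.

(** With [j = m - k] the sum becomes the binomial polynomial of exponent [sigma + m], cut at degree
    [m - n < sigma + m]. *)
Lemma sum_bin_weight_le (R : realType) (sigma x : R) n m :
  0 < sigma + n%:R -> 0 <= x -> (n <= m)%N ->
  \sum_(n <= k < m.+1) 'C(m, k)%:R * x ^+ (m - k) * weight sigma n k
    <= weight sigma n m * (1 + x) `^ (sigma + m%:R).
Proof.
move=> sn x0 nm; rewrite big_rev_mkord subSn //.
have := @binom_poly_le_powR R (m - n) (sigma + m%:R) x _ x0.
rewrite natrB // => /(_ _) /wrap[]; first by lra.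
rewrite horner_poly => H.
apply: le_trans (ler_wpM2l (ltW (weight_gt0 m sn)) H).
rewrite mulr_sumr le_eqVlt; apply/orP; left; apply/eqP.
apply: eq_bigr => j _; have jm : (j <= m - n)%N by rewrite -ltnS.
rewrite subSS mulrAC bin_weight // subKn ?mulrA //; lia.
Qed.

(** For [i >= n] one has [sigma + i <= (1 + tau) i]. With small [tau], the weight decays no faster
    than an exponential of base near 1. *)
Lemma weight_ge (R : realType) (sigma tau : R) n m :
  0 < sigma + n%:R -> 0 <= tau -> sigma <= tau * n%:R ->
  ((1 + tau) ^+ m)^-1 <= weight sigma n m.
Proof.
move=> sn t0 st.
rewrite -[leLHS]mul1r ler_pdivrMr ?exprn_gt0 ?ltr_wpDr // mulrAC.
rewrite ler_pdivlMr ?mul1r; last first.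
  rewrite big_nat; apply: prodr_gt0 => i /andP[ki _].
  by apply: lt_le_trans sn _; rewrite lerD2l ler_nat.
elim: m => [|m IH].
  case: n sn st => [|n] sn st; last by rewrite big_geq // fact0 expr0 mulr1.
  by rewrite big_nat1 fact0 expr0; move: st; rewrite mulr0 addr0 mulr1; lra.
have [nm|nm] := leqP n m.+1; last first.
  by rewrite big_geq // mulr_ege1 ?exprn_ege1 ?lerDl // ler1n fact_gt0.
rewrite big_nat_recr //= factS natrM exprS.
have nm' : n%:R <= m.+1%:R :> R by rewrite ler_nat.
have -> : m.+1%:R * m`!%:R * ((1 + tau) * (1 + tau) ^+ m) =
   (m`!%:R * (1 + tau) ^+ m) * (m.+1%:R * (1 + tau)) by ring.
apply: ler_pM => //.
- rewrite big_nat; apply: prodr_ge0 => i /andP[ki _].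
  by apply: le_trans (ltW sn) _; rewrite lerD2l ler_nat.
- by apply: le_trans (ltW sn) _; rewrite lerD2l.
- rewrite mulrDr mulr1 addrC lerD2l; apply: le_trans st _.
  by rewrite mulrC ler_wpM2r.
Qed.

(** * The real recurrence inequality *)

Section RealRecurrence.
Variables (R : realType) (b : nat) (hb : (1 < b)%N) (A : {set 'I_b}).
Hypothesis hA : exists2 a : 'I_b, a \in A & nat_of_ord a != 0%N.

Let f := max_digit A.
Let lam : R := lambda R A.
Let N := #|A|.

(** The rate of the error terms: [b * ratio = b - 1/4] lies strictly between [b - 1/2], the base of
    the low terms divided by [lam], and [b]. *)
Definition ratio : R := 1 - (4 * b%:R)^-1.

Lemma b_ge2 : 2 <= b%:R :> R. Proof. by rewrite ler_nat. Qed.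

Lemma le_max_digit a : a \in A -> (a <= f)%N.
Proof. by move=> aA; rewrite /f /max_digit (leq_bigmax_cond _ aA). Qed.

Lemma max_digit_gt0 : (0 < f)%N.
Proof.
by case: hA => a aA a0; rewrite (leq_trans _ (le_max_digit aA)) // lt0n.
Qed.

Lemma max_digit_lt : (f < b)%N.
Proof.
suff : (f <= b.-1)%N by move: hb; lia.
by apply/bigmax_leqP => a _; have := ltn_ord a; lia.
Qed.

Lemma max_digitE : f%:R = lam * (b%:R - 1).
Proof. by rewrite /lam /lambda divfK // gt_eqF //; have := b_ge2; lra. Qed.

Lemma lambda_gt0 : 0 < lam.
Proof.
by rewrite /lam /lambda divr_gt0 ?ltr0n ?max_digit_gt0 //; have := b_ge2; lra.
Qed.

Lemma lambda_le1 : lam <= 1.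
Proof.
rewrite /lam /lambda ler_pdivrMr; last by have := b_ge2; lra.
by rewrite mul1r lerBrDr natr1 ler_nat max_digit_lt.
Qed.

Lemma ratioE : b%:R * ratio = b%:R - 4^-1.
Proof. by rewrite /ratio; field; have := b_ge2; lra. Qed.

Lemma ratio_ge : 2^-1 <= ratio.
Proof.
rewrite -(ler_pM2l (_ : 0 < b%:R)) ?ratioE; have := b_ge2; lra.
Qed.

Lemma ratio_lt1 : ratio < 1.
Proof.
rewrite -(ltr_pM2l (_ : 0 < b%:R)) ?ratioE; have := b_ge2; lra.
Qed.

Lemma gammaE j : (gamma A j)%:R = \sum_(a in A) a%:R ^+ j :> R.
Proof. by rewrite /gamma natr_sum; apply: eq_bigr => a _; rewrite natrX. Qed.

(** Here [a <= f - 1], so [1 + a / lam <= b - 1 / lam <= b - 1]. *)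
Lemma small_digit_le (a : 'I_b) : a \in A -> a != f :> nat ->
  1 + a%:R / lam <= b%:R * ratio.
Proof.
move=> aA af; have {}aA : (a < f)%N by rewrite ltn_neqAle af le_max_digit.
have aA1 : a%:R + 1 <= f%:R :> R by rewrite natr1 ler_nat.
have l0 := lambda_gt0; have l1 := lambda_le1.
rewrite -(ler_pM2l l0) ratioE mulrDr mulrCA divff ?gt_eqF // !mulr1.
by move: aA1; rewrite max_digitE; nra.
Qed.

(* The largest digit reproduces the weight; each other digit contributes an
   exponentially smaller term. *)
Lemma sum_digits_powR_le (p : R) : 0 <= p ->
  \sum_(a in A) (1 + a%:R / lam) `^ p <= b%:R `^ p * (1 + N%:R * ratio `^ p).
Proof.
move=> p0.
have l0 := lambda_gt0; have b2 := b_ge2; have r2 := ratio_ge.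
have [a0 fa0] : exists a : 'I_b, nat_of_ord a = f by exists (Ordinal max_digit_lt).
(* [1 + f / lam = b] for the largest digit [a0]; the second term, summed over [A], gives the factor
   [N]. *)
have bound (a : 'I_b) : a \in A -> (1 + a%:R / lam) `^ p <=
    b%:R `^ p * (a == a0)%:R + b%:R `^ p * ratio `^ p.
  move=> aA; case: eqP => [->|/eqP ne].
    rewrite mulr1 fa0 max_digitE mulrAC divff ?gt_eqF // mul1r [1 + _]addrC subrK.
    by rewrite lerDl mulr_ge0 ?powR_ge0.
  rewrite mulr0 add0r -powRM; [|lra|lra].
  apply: ge0_ler_powR => //; rewrite ?nnegrE.
  - by rewrite addr_ge0 // divr_ge0 // ltW.
  - by rewrite mulr_ge0 //; lra.
  - by apply: small_digit_le => //; rewrite -fa0.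
apply: le_trans (ler_sum _ bound) _.
rewrite big_split /= -mulr_sumr sumr_const -/N -[X in _ + X]mulr_natr.
rewrite mulrDr lerD //; last by rewrite [N%:R * _]mulrC mulrA.
rewrite ler_wpM2l ?powR_ge0 //.
have [a0A|a0A] := boolP (a0 \in A).
  by rewrite (bigD1 a0) //= eqxx big1 ?addr0 // => a /andP[_ /negPf ->].
rewrite big1 // => a aA; case: eqP => // E; by rewrite -E aA in a0A.
Qed.

(* Uses [('C(m, k) f^(m-k) (lam/2)^k <= (f + lam/2)^m]. *)
Lemma sum_low_le n m (a : 'I_b) : a \in A -> (n <= m)%N ->
  \sum_(0 <= k < n) 'C(m, k)%:R * a%:R ^+ (m - k)
    <= (2 / lam) ^+ n * (lam * (b%:R - 2^-1)) ^+ m.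
Proof.
move=> aA nm; have l0 := lambda_gt0; have l0' := ltW l0; have l1 := lambda_le1.
have -> : lam * (b%:R - 2^-1) = f%:R + lam / 2 by rewrite max_digitE; field.
rewrite exprDn mulr_sumr -(big_mkord xpredT
  (fun i => (2 / lam) ^+ n * (f%:R ^+ (m - i) * (lam / 2) ^+ i *+ 'C(m, i)))).
rewrite [leRHS](@big_cat_nat _ _ _ n) //=; last by lia.
rewrite -[leLHS]addr0 lerD //; last first.
  apply: sumr_ge0 => k _.
  apply: mulr_ge0; first by rewrite exprn_ge0 // divr_ge0.
  by apply/mulrn_wge0/mulr_ge0; rewrite exprn_ge0 // divr_ge0.
rewrite !big_nat; apply: ler_sum => k /andP[_ kn].
(* Since [k < n] and [lam <= 1], the scaling leaves [(2 / lam)^(n - k) >= 1]. *)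
have -> : (2 / lam) ^+ n * (f%:R ^+ (m - k) * (lam / 2) ^+ k *+ 'C(m, k)) =
  ('C(m, k)%:R * f%:R ^+ (m - k)) * (2 / lam) ^+ (n - k).
  rewrite -{1}(subnK (ltnW kn)) exprD -[_ *+ 'C(m, k)]mulr_natr.
  have E : (2 / lam) ^+ k * (lam / 2) ^+ k = 1.
    by rewrite -exprMn [X in X ^+ k](_ : _ = 1) ?expr1n //; field; rewrite gt_eqF.
  rewrite -[RHS]mulr1 -[X in _ = _ * X]E.
  set x := (2 / lam) ^+ k; set y := (lam / 2) ^+ k; set z := (2 / lam) ^+ (n - k).
  by set w := _ ^+ (m - k); ring.
rewrite -[leLHS]mulr1 ler_pM ?mulr_ge0 ?exprn_ge0 //.
  by rewrite ler_wpM2l // lerXn2r ?nnegrE // ler_nat le_max_digit.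
by rewrite exprn_ege1 // ler_pdivlMr //; lra.
Qed.

(** Removes the [N] of [b^(sigma + m) - N]: [n <= E / 2] absorbs [n * y] and [n * x], and
    [n <= E * x] absorbs the remaining [n]. *)
Lemma absorb_denominator (E n U V x y : R) :
  0 < E -> 0 <= n -> n <= E / 2 -> n <= E * x -> 0 <= V -> 0 <= y ->
  (E - n) * U <= E * (V * (1 + y)) -> U <= V * (1 + 2 * (y + x)).
Proof.
move=> E0 n0 nE nx V0 y0 H.
have En : 0 < E - n by lra.
rewrite -(ler_pM2l En); apply: le_trans H _.
rewrite mulrCA [leRHS]mulrCA ler_wpM2l //.
have x0 : 0 <= x by rewrite -(pmulr_rge0 _ E0); lra.
by nra.
Qed.

(** The summands account for the other digits, the terms below [n], and the [N] in the denominator;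
    the 2 is that of [absorb_denominator]. *)
Definition error_const q n : R :=
  2 * (N%:R * (ratio ^+ q)^-1 + N%:R * (2 / lam) ^+ n * b%:R ^+ q
       + b%:R ^+ q.+1).

Lemma powR_base_ge (sigma : R) q m : `|sigma| <= q%:R ->
  b%:R ^+ m <= b%:R `^ (sigma + m%:R) * b%:R ^+ q.
Proof.
move=> sq; have b2 := b_ge2; have b0 : 0 <= b%:R :> R by [].
rewrite -!powR_mulrn // -powRD; last by apply/implyP => _; rewrite gt_eqF //; lra.
rewrite ler_powR; first by [].
  by lra.
by move: sq; rewrite ler_norml => /andP[]; lra.
Qed.

Lemma ratio_powR_le (sigma : R) q m : `|sigma| <= q%:R ->
  ratio `^ (sigma + m%:R) <= (ratio ^+ q)^-1 * ratio ^+ m.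
Proof.
move=> sq; have r0 := ratio_ge; have r1 := ratio_lt1.
have rp : 0 < ratio by lra.
rewrite mulrC ler_pdivlMr ?exprn_gt0 //.
rewrite -!powR_mulrn ?(ltW rp) // -powRD; last by apply/implyP => _; rewrite gt_eqF.
rewrite ger_powR ?rp ?(ltW r1) //.
by move: sq; rewrite ler_norml => /andP[]; lra.
Qed.

(** By [powR_base_ge], and [weight_ge] with [tau = 1 / (4 b)], allowed by [4 b q <= n], this reduces
    to [(1 + tau) (b - 1/2) <= b - 1/4 = b * ratio]. *)
Lemma low_weight (sigma : R) q n m : `|sigma| <= q%:R ->
  0 < sigma + n%:R -> (4 * b * q <= n)%N ->
  (lam * (b%:R - 2^-1)) ^+ m <= 
  lam ^+ m * weight sigma n m * b%:R `^ (sigma + m%:R) * (b%:R ^+ q * ratio ^+ m).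
Proof.
move=> sq sn qn.
have b2 := b_ge2; have r0 := ratio_ge; have l0 := lambda_gt0.
pose tau : R := (4 * b%:R)^-1.
have t0 : 0 <= tau by rewrite invr_ge0; lra.
have sw : sigma <= tau * n%:R.
  apply: le_trans (ler_norm _) _; apply: le_trans sq _.
  by rewrite ler_pdivlMl; [rewrite -!natrM ler_nat | lra].
have := weight_ge m sn t0 sw; move: (weight _ _ _) => w W.
rewrite exprMn -!mulrA ler_wpM2l ?exprn_ge0 ?(ltW l0) //.
apply: (@le_trans _ _ (((1 + tau) ^+ m)^-1 * (b%:R ^+ m * ratio ^+ m))); last first.
  rewrite ler_pM // ?invr_ge0 ?mulr_ge0 ?exprn_ge0 //; try lra.
  rewrite mulrA ler_wpM2r ?exprn_ge0 //; first by lra.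
  exact: powR_base_ge.
rewrite -exprMn ratioE -exprVn -exprMn lerXn2r ?nnegrE //; first by lra.
  by rewrite mulr_ge0 ?invr_ge0 //; lra.
rewrite ler_pdivlMl; last by lra.
have : tau * b%:R = 4^-1 by rewrite /tau; field; lra.
by nra.
Qed.

(** The power sums are split into digits. For each digit, [sum_low_le] handles the terms below [n],
    and [sum_bin_weight_le] at [x = a / lam] the others. *)
Lemma sum_digits_recurrence_le (sigma C0 B : R) n m (U : nat -> R) :
  0 < sigma + n%:R -> (n <= m)%N -> 0 <= C0 -> 0 <= B ->
  (forall k, (k < n)%N -> U k <= C0) ->
  (forall k, (n <= k < m)%N -> U k <= B * (lam ^+ k * weight sigma n k)) ->
  \sum_(0 <= k < m) 'C(m, k)%:R * (gamma A (m - k))%:R * U k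
  <= N%:R * (C0 * ((2 / lam) ^+ n * (lam * (b%:R - 2^-1)) ^+ m))
   + B * (lam ^+ m * weight sigma n m) *
     \sum_(a in A) (1 + a%:R / lam) `^ (sigma + m%:R).
Proof.
move=> sn nm C0p B0 Ulow Uhigh; have l0 := lambda_gt0.
under eq_bigr => k _ do rewrite gammaE mulr_sumr mulr_suml.
rewrite exchange_big /= mulr_sumr mulr_natl -sumr_const -big_split /=.
apply: ler_sum => a aA.
rewrite (@big_cat_nat _ _ _ n) //= lerD //.
  apply: le_trans (ler_wpM2l C0p (sum_low_le aA nm)).
  rewrite mulr_sumr !big_nat; apply: ler_sum => k /andP[_ kn].
  by rewrite mulrC ler_wpM2r ?Ulow // mulr_ge0 ?exprn_ge0.
have al : 0 <= a%:R / lam by rewrite divr_ge0 // ltW.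
have Bl : 0 <= B * lam ^+ m by rewrite mulr_ge0 ?exprn_ge0 // ltW.
rewrite mulrA -[leRHS]mulrA.
apply: le_trans (ler_wpM2l Bl (sum_bin_weight_le sn al nm)).
(* The binomial sum has one more term, [k = m], which is nonnegative. *)
rewrite big_nat_recr //= mulrDr -[leLHS]addr0 lerD //; last first.
  apply: mulr_ge0 => //; apply: mulr_ge0; last exact: ltW (weight_gt0 m sn).
  by rewrite mulr_ge0 // exprn_ge0.
rewrite mulr_sumr !big_nat; apply: ler_sum => k /andP[nk km].
have -> : B * lam ^+ m * ('C(m, k)%:R * (a%:R / lam) ^+ (m - k) * weight sigma n k)
  = 'C(m, k)%:R * a%:R ^+ (m - k) * (B * (lam ^+ k * weight sigma n k)).
  rewrite [(a%:R / lam) ^+ _]expr_div_n.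
  have -> : lam ^+ m = lam ^+ (m - k) * lam ^+ k by rewrite -exprD subnK // ltnW.
  have : lam ^+ (m - k) != 0 by rewrite expf_neq0 // gt_eqF.
  set x := lam ^+ (m - k); set y := lam ^+ k; set z := a%:R ^+ (m - k).
  by move: (weight _ _ _) => w x0; field.
apply: ler_wpM2l; first by rewrite mulr_ge0 // exprn_ge0.
by rewrite Uhigh // nk.
Qed.

(** One induction step: the excess factors over [B] form a convergent product. *)
Lemma recurrence_step (sigma C0 B : R) q n m (U : nat -> R) :
  `|sigma| <= q%:R -> (4 * b * q <= n)%N -> (q.+2 <= n)%N -> (n <= m)%N ->
  0 <= C0 -> C0 <= B ->
  (forall k, (k < n)%N -> U k <= C0) ->
  (forall k, (n <= k < m)%N -> U k <= B * (lam ^+ k * weight sigma n k)) ->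
  (b%:R `^ (sigma + m%:R) - N%:R) * U m <=
    \sum_(0 <= k < m) 'C(m, k)%:R * (gamma A (m - k))%:R * U k ->
  U m <= B * (1 + error_const q n * ratio ^+ m) * (lam ^+ m * weight sigma n m).
Proof.
move=> sq qn qn2 nm C0p C0B Ulow Uhigh Urec.
have b2 := b_ge2; have r2 := ratio_ge; have r1 := ratio_lt1; have l0 := lambda_gt0.
have B0 : 0 <= B by lra.
have sn : 0 < sigma + n%:R.
  have : q.+1%:R <= n%:R :> R by rewrite ler_nat; lia.
  by move: sq; rewrite ler_norml -natr1 => /andP[]; lra.
have P0 : 0 <= sigma + m%:R.
  by apply: le_trans (ltW sn) _; rewrite lerD2l ler_nat.
set E := b%:R `^ _ in Urec; have E0 : 0 < E by rewrite powR_gt0; lra.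
set W := lam ^+ m * _; have W0 : 0 < W by rewrite mulr_gt0 ?exprn_gt0 ?weight_gt0.
have Nb : N%:R <= b%:R :> R by rewrite ler_nat -[leqRHS]card_ord max_card.
have bq : 1 <= b%:R ^+ q :> R by rewrite exprn_ege1 //; lra.
have Em : b%:R ^+ m <= E * b%:R ^+ q := powR_base_ge m sq.
have lw := low_weight m sq sn qn; rewrite -/W -/E in lw.
set y := N%:R * (ratio ^+ q)^-1 * ratio ^+ m
         + N%:R * (2 / lam) ^+ n * b%:R ^+ q * ratio ^+ m.
have rq0 : 0 <= (ratio ^+ q)^-1 by rewrite invr_ge0 exprn_ge0 //; lra.
have rm0 : 0 <= ratio ^+ m by rewrite exprn_ge0 //; lra.
have lb0 : 0 <= (2 / lam) ^+ n by rewrite exprn_ge0 // divr_ge0 // ltW.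
have y0 : 0 <= y by rewrite /y addr_ge0 // ?mulr_ge0 //; lra.
have -> : B * (1 + error_const q n * ratio ^+ m) * W =
    B * W * (1 + 2 * (y + b%:R ^+ q.+1 * ratio ^+ m)).
  by rewrite /error_const /y; ring.
apply: (@absorb_denominator E N%:R) => //.
(* [b^(q+2) <= b^m <= E b^q] gives [E >= b^2 >= 2 b >= 2 N]. *)
- have : b%:R ^+ (q.+2) <= b%:R ^+ m :> R by rewrite ler_weXn2l ?(leq_trans qn2) //; lra.
  move=> /le_trans /(_ Em); rewrite -addn2 exprD mulrC ler_pM2r; last by lra.
  by rewrite expr2; nra.
- apply: le_trans Nb _; rewrite exprS.
  (* Since [b * ratio >= 1] and [b^m <= E b^q], also [E b^q ratio^m >= 1]. *)
  have : 1 <= (b%:R * ratio) ^+ m by rewrite exprn_ege1 // ratioE; lra.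
  rewrite exprMn => /le_trans /(_ (ler_wpM2r rm0 Em)) H.
  have -> : E * (b%:R * b%:R ^+ q * ratio ^+ m) =
     b%:R * (E * b%:R ^+ q * ratio ^+ m) by ring.
  by rewrite ler_peMr.
- by rewrite mulr_ge0 // ltW.
apply: le_trans Urec _.
apply: le_trans (sum_digits_recurrence_le sn nm C0p B0 Ulow Uhigh) _.
rewrite -/W.
have N0 : 0 <= N%:R :> R by [].
have BW0 : 0 <= B * W by rewrite mulr_ge0 // ltW.
(* [C0 <= B] and [low_weight] turn the low terms into a multiple of [B * W * E] of order
   [ratio^m]. *)
apply: (@le_trans _ _ (N%:R * (B * ((2 / lam) ^+ n * (W * E * (b%:R ^+ q * ratio ^+ m))))
   + B * W * (E * (1 + N%:R * ((ratio ^+ q)^-1 * ratio ^+ m))))).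
  apply: lerD.
    have lb1 : 0 <= lam * (b%:R - 2^-1) by rewrite mulr_ge0 ?(ltW l0) //; lra.
    apply: ler_wpM2l => //; apply: ler_pM => //; last exact: ler_wpM2l.
    by rewrite mulr_ge0 // exprn_ge0.
  rewrite ler_wpM2l //; apply: le_trans (sum_digits_powR_le P0) _.
  by rewrite ler_wpM2l ?(ltW E0) // lerD2l ler_wpM2l // ratio_powR_le.
by rewrite le_eqVlt /y; apply/orP; left; apply/eqP; ring.
Qed.

(** [M] is chosen before [sigma] and [U]; this is the source of the uniformity in [s]. *)
Lemma recurrence_bound (C0 : R) q n : 0 <= C0 ->
  (4 * b * q <= n)%N -> (q.+2 <= n)%N ->
  exists M : R, 0 <= M /\ forall (sigma : R) (U : nat -> R), `|sigma| <= q%:R ->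
  (forall k, (k < n)%N -> U k <= C0) ->
  (forall m, (n <= m)%N -> (b%:R `^ (sigma + m%:R) - N%:R) * U m <=
    \sum_(0 <= k < m) 'C(m, k)%:R * (gamma A (m - k))%:R * U k) ->
  forall m, (n <= m)%N -> U m <= M * (lam ^+ m * weight sigma n m).
Proof.
move=> C00 qn qn2; set C := error_const q n.
have b2 := b_ge2; have r2 := ratio_ge; have r1 := ratio_lt1; have l0 := lambda_gt0.
have r0 : 0 <= ratio by lra.
have lb0 : 0 <= 2 / lam by rewrite divr_ge0 // ltW.
have Cp : 0 <= C.
  apply: mulr_ge0 => //; apply: addr_ge0; last exact: exprn_ge0.
  apply: addr_ge0; first by rewrite mulr_ge0 // invr_ge0 exprn_ge0.
  by rewrite mulr_ge0 ?exprn_ge0 // mulr_ge0 // exprn_ge0.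
have W0 sigma m : `|sigma| <= q%:R -> 0 < lam ^+ m * weight sigma n m.
  move=> sq; rewrite mulr_gt0 ?exprn_gt0 ?weight_gt0 //.
  have : q.+1%:R <= n%:R :> R by rewrite ler_nat; lia.
  by move: sq; rewrite ler_norml -natr1 => /andP[]; lra.
have Cr i : 0 <= C * ratio ^+ i by rewrite mulr_ge0 // exprn_ge0.
pose Pr m := \prod_(i < m) (1 + C * ratio ^+ i).
have Pge1 m : 1 <= Pr m.
  by rewrite /Pr; elim/big_rec: _ => // i x _ x1; rewrite mulr_ege1 // lerDl.
have Pmono k m : (k <= m)%N -> Pr k <= Pr m.
  move=> km; rewrite -(subnK km); elim: (m - k)%N => [//|j IH].
  apply: le_trans IH _; rewrite addSn /Pr big_ord_recr /= ler_peMr //.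
    by apply: le_trans ler01 (Pge1 _).
  by rewrite lerDl.
exists (C0 * expR (C / (1 - ratio))); split; first by rewrite mulr_ge0 ?expR_ge0.
move=> sigma U sq Ulow Urec m nm.
(* The induction carries the increasing partial products [Pr], so earlier bounds stay valid with the
   current constant. *)
suff H : U m <= C0 * Pr m.+1 * (lam ^+ m * weight sigma n m).
  apply: le_trans H _; rewrite ler_wpM2r ?(ltW (W0 _ _ sq)) // ler_wpM2l //.
  by rewrite prod_geometric_le ?r0.
elim/ltn_ind: m nm => m IH nm.
have C0P : C0 <= C0 * Pr m by rewrite ler_peMr.
have PrS : C0 * Pr m.+1 = C0 * Pr m * (1 + C * ratio ^+ m).
  by rewrite /Pr big_ord_recr mulrA.
rewrite PrS; apply: (recurrence_step sq qn qn2 nm C00 C0P Ulow _ (Urec m nm)).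
move=> k /andP[nk km].
apply: le_trans (IH k km nk) _; apply: ler_wpM2r; first exact/ltW/W0.
by rewrite ler_wpM2l // Pmono.
Qed.

End RealRecurrence.

(** * Modulus and complex powers *)

Section ComplexPower.
Variable R : realType.
Implicit Types (z w : Cpx R) (a : R).

(** The norm of [Cpx R] takes its values in [Cpx R]; this copy takes them in [R]. *)
Definition cnorm z : R := complex.Re `|z|.

Lemma cnormE z : `|z| = (cnorm z)%:C.
Proof. by rewrite /cnorm normc_def. Qed.

Lemma cnorm_le z a : (`|z| <= a%:C) = (cnorm z <= a).
Proof. by rewrite cnormE lecR. Qed.

Lemma cnorm_ge0 z : 0 <= cnorm z.
Proof. by rewrite -lecR -cnormE; apply: normr_ge0. Qed.

Lemma cnormM z w : cnorm (z * w) = cnorm z * cnorm w.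
Proof. by apply: (@complexI R); rewrite rmorphM -!cnormE normrM. Qed.

Lemma cnormD z w : cnorm (z + w) <= cnorm z + cnorm w.
Proof. by rewrite -lecR rmorphD -!cnormE ler_normD. Qed.

Lemma cnormB z w : cnorm z - cnorm w <= cnorm (z - w).
Proof. by rewrite lerBlDr; have := cnormD (z - w) w; rewrite subrK. Qed.

Lemma cnormN z : cnorm (- z) = cnorm z.
Proof. by rewrite /cnorm normrN. Qed.

Lemma cnorm_nat n : cnorm n%:R = n%:R.
Proof. by apply: (@complexI R); rewrite -cnormE normr_nat rmorph_nat. Qed.

Lemma cnormV z : cnorm z^-1 = (cnorm z)^-1.
Proof. by apply: (@complexI R); rewrite fmorphV -!cnormE normfV. Qed.

Lemma cnorm_prod (I : Type) (r : seq I) (P : pred I) (F : I -> Cpx R) :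
  cnorm (\prod_(i <- r | P i) F i) = \prod_(i <- r | P i) cnorm (F i).
Proof.
by apply: (big_morph _ cnormM); rewrite -[1]/(1%:R) cnorm_nat.
Qed.

Lemma cnorm_sum (I : Type) (r : seq I) (P : pred I) (F : I -> Cpx R) :
  cnorm (\sum_(i <- r | P i) F i) <= \sum_(i <- r | P i) cnorm (F i).
Proof.
elim/big_rec2: _ => [|i x y _ H]; first by rewrite -[0]/(0%:R) cnorm_nat.
by apply: le_trans (cnormD _ _) _; rewrite lerD2l.
Qed.

Lemma Re_le_cnorm z : `|complex.Re z| <= cnorm z.
Proof. by rewrite -lecR -cnormE normc_ge_Re. Qed.

Lemma ReD_nat z n : complex.Re (z + n%:R) = complex.Re z + n%:R.
Proof. by rewrite raddfD /= -(rmorph_nat (real_complex R)). Qed.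

Lemma cnorm_sqr z : cnorm z ^+ 2 = complex.Re z ^+ 2 + complex.Im z ^+ 2.
Proof. by rewrite /cnorm normc_def /= sqr_sqrtr // addr_ge0 ?sqr_ge0. Qed.

Lemma ImD_nat z n : complex.Im (z + n%:R) = complex.Im z.
Proof. by rewrite raddfD /= -(rmorph_nat (real_complex R)) /= addr0. Qed.

Lemma cnorm_rpowC a z : cnorm (rpowC a z) = a `^ complex.Re z.
Proof.
apply/eqP; rewrite -(@eqrXn2 _ 2) ?cnorm_ge0 ?powR_ge0 //; apply/eqP.
by rewrite cnorm_sqr /= !exprMn -mulrDr cos2Dsin2 mulr1.
Qed.

Lemma rpowCD a z w : 0 < a -> rpowC a (z + w) = rpowC a z * rpowC a w.
Proof.
case: z w => [x y] [x' y'] a0; rewrite /rpowC /=.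
rewrite powRD; last by apply/implyP => _; rewrite gt_eqF.
rewrite mulrDl cosD sinD; apply/eqP; rewrite eq_complex /=.
by apply/andP; split; apply/eqP; ring.
Qed.

Lemma rpowC0 a : rpowC a 0 = 1.
Proof. by rewrite /rpowC /= powRr0 mul0r cos0 sin0 mulr1 mulr0. Qed.

Lemma rpowCN a z : 0 < a -> rpowC a z * rpowC a (- z) = 1.
Proof. by move=> a0; rewrite -rpowCD // subrr rpowC0. Qed.

End ComplexPower.

(** * The factors of [alpha] and the first moments *)

Section Factor.
Variables (R : realType) (b : nat) (hb : (1 < b)%N) (A : {set 'I_b}).
Implicit Type z : Cpx R.

Definition factor z n : Cpx R := 1 - rpowC b%:R (- z - n%:R) * #|A|%:R.

Definition regular z := forall n, rpowC b%:R (z + n%:R) != #|A|%:R :> Cpx R.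

Lemma b_gt0 : 0 < b%:R :> R. Proof. by rewrite ltr0n; lia. Qed.

(** Multiplication by [factor z n] thus clears the denominator that the recurrence introduces in
    [u A n]. *)
Lemma factorE z n :
  rpowC b%:R (z + n%:R) * factor z n = rpowC b%:R (z + n%:R) - #|A|%:R.
Proof. by rewrite /factor -opprD mulrBr mulr1 mulrA rpowCN ?mul1r // b_gt0. Qed.

Definition factor_bound q : R := expR (#|A|%:R * b%:R ^+ q / (1 - b%:R^-1)).

Lemma cnorm_factor_le q z n : cnorm z <= q%:R ->
  cnorm (factor z n) <= 1 + #|A|%:R * b%:R ^+ q * b%:R^-1 ^+ n.
Proof.
move=> zq; have b0 := b_gt0.
rewrite /factor; apply: le_trans (cnormD _ _) _; rewrite cnormN cnormM cnorm_nat.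
rewrite -[X in cnorm X]/(1%:R) cnorm_nat lerD2l mulrC -mulrA ler_wpM2l //.
rewrite cnorm_rpowC -powR_mulrn ?(ltW b0) // exprVn -powR_mulrn ?(ltW b0) // -powRN.
rewrite -powRD; last by apply/implyP => _; rewrite gt_eqF.
rewrite ler_powR //; first by rewrite ler1n; lia.
rewrite -opprD -[- _]/(- _ : Cpx R) raddfN /= ReD_nat.
have := le_trans (Re_le_cnorm z) zq; rewrite ler_norml => /andP[]; lra.
Qed.

(** The majorants of the factors are at least 1, so completing the range down to 0 only increases
    their product. *)
Lemma cnorm_prod_factor_le q z l k : cnorm z <= q%:R ->
  cnorm (\prod_(l <= i < k) factor z i) <= factor_bound q.
Proof.
move=> zq; have b0 := b_gt0.
have b1 : 0 <= (b%:R^-1 : R) < 1 by rewrite invr_ge0 ltW //= invf_lt1 // ltr1n.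
have C0 : 0 <= #|A|%:R * b%:R ^+ q :> R by rewrite mulr_ge0 // exprn_ge0 // ltW.
apply: le_trans (prod_geometric_le k C0 b1); rewrite cnorm_prod.
rewrite -(big_mkord xpredT (fun i => 1 + #|A|%:R * b%:R ^+ q * b%:R^-1 ^+ i)).
have ge1 i : 1 <= 1 + #|A|%:R * b%:R ^+ q * b%:R^-1 ^+ i :> R.
  by rewrite lerDl mulr_ge0 // exprn_ge0; case/andP: b1.
have pge1 s : 1 <= \prod_(i <- s) (1 + #|A|%:R * b%:R ^+ q * b%:R^-1 ^+ i) :> R.
  by elim/big_rec: _ => // i x _ x1; rewrite mulr_ege1.
have [lk|kl] := leqP l k; last by rewrite big_geq ?pge1 // ltnW.
rewrite [leRHS](@big_cat_nat _ _ _ l) //= -[leLHS]mul1r.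
apply: ler_pM => //; last first.
  by apply: ler_prod => i _; rewrite cnorm_ge0 cnorm_factor_le.
by apply: prodr_ge0 => i _; apply: cnorm_ge0.
Qed.

(** The first [k + 1] factors cancel all denominators of [u A k], so the product stays bounded near
    the poles. *)
Lemma low_moment_bound q m : exists C : R, 0 <= C /\
  forall z k, cnorm z <= q%:R -> regular z -> (k <= m)%N ->
    cnorm (\prod_(0 <= i < k.+1) factor z i * u A k z) <= C.
Proof.
have b0 := b_gt0; have b1 : 1 <= b%:R :> R by rewrite ler1n; lia.
elim: m => [|m [C [C0 IH]]].
  (* [u A 0] is the reciprocal of the first factor, hence the constant 1. *)
  exists 1; split=> // z k zq zr; rewrite leqn0 => /eqP ->.
  have /eqP := factorE z 0; rewrite big_nat1 u0E addr0 mulrA => /eqP E.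
  have z0 := zr 0%N; rewrite addr0 in z0.
  by rewrite [factor z 0 * _]mulrC E divff ?subr_eq0 // -[1]/(1%:R) cnorm_nat.
pose S := \sum_(1 <= j < m.+2) 'C(m.+1, j)%:R * (gamma A j)%:R * (C * factor_bound q).
have K0 : 0 <= factor_bound q by apply: expR_ge0.
have S0 : 0 <= S by apply: sumr_ge0 => j _; rewrite !mulr_ge0.
have bq0 : 0 <= b%:R ^+ q * S by rewrite mulr_ge0 // exprn_ge0 // ltW.
exists (C + b%:R ^+ q * S); split; first by rewrite addr_ge0.
move=> z k zq zr; rewrite leq_eqVlt => /predU1P[->|km]; last first.
  by apply: le_trans (IH z k zq zr km) _; rewrite lerDl.
suff H : cnorm (\prod_(0 <= i < m.+2) factor z i * u A m.+1 z) <= b%:R ^+ q * S.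
  by apply: le_trans H _; rewrite lerDr.
rewrite big_nat_recr //=.
have p0 : cnorm (rpowC b%:R (z + m.+1%:R)) > 0 by rewrite cnorm_rpowC powR_gt0.
rewrite -(ler_pM2l p0) -cnormM.
have -> : rpowC b%:R (z + m.+1%:R) *
   (\prod_(0 <= i < m.+1) factor z i * factor z m.+1 * u A m.+1 z) =
   \sum_(1 <= j < m.+2) 'C(m.+1, j)%:R * (gamma A j)%:R *
      (\prod_(0 <= i < m.+1) factor z i * u A (m.+1 - j) z).
  have := @u_rec R b A z m.+1 isT (zr m.+1); rewrite -factorE => E.
  transitivity (\prod_(0 <= i < m.+1) factor z i *
    (rpowC b%:R (z + m.+1%:R) * factor z m.+1 * u A m.+1 z)); first by ring.
  by rewrite E mulr_sumr; apply: eq_bigr => j _; ring.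
apply: (@le_trans _ _ S).
  apply: le_trans (cnorm_sum _ _ _) _; rewrite /S [leLHS]big_nat [leRHS]big_nat.
  apply: ler_sum => j /andP[j0 jm].
  rewrite !cnormM !cnorm_nat -cnormM ler_wpM2l //.
  (* The factors beyond index [m + 1 - j] are surplus for [u A (m.+1 - j)]; [factor_bound] covers
     them. *)
  rewrite (@big_cat_nat _ _ _ (m.+1 - j).+1) //=; last by lia.
  rewrite mulrAC cnormM ler_pM ?cnorm_ge0 ?cnorm_prod_factor_le //.
  by apply: IH => //; lia.
(* [b^q |b^(z + m + 1)| >= 1] because [Re z >= -q]. *)
rewrite mulrA ler_peMl // cnorm_rpowC ReD_nat.
rewrite -powR_mulrn ?(ltW b0) // -powRD; last by apply/implyP => _; rewrite gt_eqF.
rewrite -[leLHS](powRr0 b%:R) ler_powR //.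
have := le_trans (Re_le_cnorm z) zq; rewrite ler_norml => /andP[zl _].
by rewrite -natr1; have : 0 <= m%:R :> R by []; lra.
Qed.

End Factor.

(** * Comparison of the Pochhammer symbol with the weight *)

Section Pochhammer.
Variable R : realType.
Implicit Type z : Cpx R.

(** As [|z + i|^2 = S^2 + (Im z)^2] with [S = Re z + i >= d = i - q], the relative excess of
    [|z + i|] over [S] is at most [q^2 / d^2]; the bound [1 / d^2 <= 1 / (d - 1) - 1 / d] makes it
    telescope. *)
Lemma cnorm_shift_le q z i : cnorm z <= q%:R -> (q.+1 < i)%N ->
  cnorm (z + i%:R) <=
  (complex.Re z + i%:R) * (1 + q%:R ^+ 2 * ((i%:R - q%:R - 1)^-1 - (i%:R - q%:R)^-1)).
Proof.
move=> zq qi; have iq : q%:R + 2 <= i%:R :> R by rewrite -natrD ler_nat; lia.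
have := le_trans (Re_le_cnorm z) zq; rewrite ler_norml => /andP[zl _].
set S := complex.Re z + i%:R; set d : R := i%:R - q%:R.
have d2 : 2 <= d by rewrite /d; lra.
have Sd : d <= S by rewrite /S /d; lra.
have q0 : 0 <= q%:R :> R by [].
have -> : (d - 1)^-1 - d^-1 = ((d - 1) * d)^-1 by field; lra.
set t := q%:R ^+ 2 / d ^+ 2.
have t0 : 0 <= t by rewrite divr_ge0 ?sqr_ge0.
apply: (@le_trans _ _ (S * (1 + t))); last first.
  apply: ler_wpM2l; first by lra.
  rewrite lerD2l; apply: ler_wpM2l; first exact: sqr_ge0.
  by rewrite lef_pV2 ?posrE; nra.
rewrite -(@ler_pXn2r _ 2) ?nnegrE ?cnorm_ge0 //; last by apply: mulr_ge0; lra.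
rewrite cnorm_sqr ReD_nat ImD_nat -/S.
have yq : complex.Im z ^+ 2 <= t * d ^+ 2.
  rewrite /t divfK; last by rewrite expf_neq0 // gt_eqF //; lra.
  apply: (@le_trans _ _ (cnorm z ^+ 2)).
    by rewrite cnorm_sqr lerDr sqr_ge0.
  by rewrite ler_pXn2r ?nnegrE ?cnorm_ge0.
have dS : d ^+ 2 <= S ^+ 2 by rewrite ler_pXn2r ?nnegrE //; lra.
by rewrite exprMn; have := sqr_ge0 S; nra.
Qed.

Lemma prod_shift_le q n z m : cnorm z <= q%:R -> (q.+2 <= n)%N -> (n <= m)%N ->
  \prod_(n <= i < m) cnorm (z + i%:R) <=
  \prod_(n <= i < m) (complex.Re z + i%:R) *
  expR (q%:R ^+ 2 * ((n%:R - q%:R - 1)^-1 - (m%:R - q%:R - 1)^-1)).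
Proof.
move=> zq qn; have := le_trans (Re_le_cnorm z) zq; rewrite ler_norml => /andP[zl _].
elim: m => [|m IH]; first by rewrite leqn0 => /eqP n0; move: qn; rewrite n0.
rewrite leq_eqVlt => /predU1P[<-|nm].
  by rewrite !big_geq // subrr mulr0 expR0 mulr1.
have Re_gt0 i : (n <= i)%N -> 0 < complex.Re z + i%:R.
  move=> ni; have : q%:R + 2 <= i%:R :> R by rewrite -natrD ler_nat; lia.
  by lra.
rewrite !big_nat_recr //=.
set X := \prod_(_ <= i < _) (complex.Re z + _).
set a := (n%:R - q%:R - 1)^-1.
have -> : q%:R ^+ 2 * (a - (m.+1%:R - q%:R - 1)^-1) =
  q%:R ^+ 2 * (a - (m%:R - q%:R - 1)^-1) +
  q%:R ^+ 2 * ((m%:R - q%:R - 1)^-1 - (m%:R - q%:R)^-1).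
  by rewrite -natr1 [_ + 1 - _]addrAC addrK; ring.
rewrite expRD mulrACA; apply: ler_pM; rewrite ?cnorm_ge0 ?IH //.
  by apply: prodr_ge0 => i _; apply: cnorm_ge0.
apply: le_trans (cnorm_shift_le zq _) _; first by lia.
rewrite ler_wpM2l ?expR_ge1Dx //; apply/ltW/Re_gt0; lia.
Qed.

(** The product in the weight runs up to [i = m], that of [(z)_m] only to [m - 1]: the factor
    [Re z + m >= m / 2] is left over and yields [1 / m]. *)
Lemma pochhammer_weight_le q n : (q.+2 <= n)%N -> (2 * q <= n)%N ->
  exists M : R, 0 <= M /\ forall z m, cnorm z <= q%:R -> (n <= m)%N ->
    cnorm (pochhammer z m) * weight (complex.Re z) n m <= M * (m`!%:R / m%:R).
Proof.
move=> qn qn2; pose K : R := expR (q%:R ^+ 2 * (n%:R - q%:R - 1)^-1).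
(* [(q + n)^n] bounds the first [n] factors, [K] the effect of the imaginary part, and 2 comes from
   [Re z + m >= m / 2]. *)
exists ((q%:R + n%:R) ^+ n * K * 2); split.
  by rewrite !mulr_ge0 ?expR_ge0 ?exprn_ge0 ?addr_ge0.
move=> z m zq nm.
have := le_trans (Re_le_cnorm z) zq; rewrite ler_norml => /andP[zl _].
have Re_gt0 i : (n <= i)%N -> 0 < complex.Re z + i%:R.
  move=> ni; have : q%:R + 2 <= i%:R :> R by rewrite -natrD ler_nat; lia.
  by lra.
have m0 : 0 < m%:R :> R by rewrite ltr0n; lia.
rewrite /weight big_nat_recr //=; set H := \prod_(n <= i < m) _.
have H0 : 0 < H.
  by rewrite /H big_nat; apply: prodr_gt0 => i /andP[ni _]; apply: Re_gt0.
have P : cnorm (pochhammer z m) <= (q%:R + n%:R) ^+ n * (H * K).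
  rewrite /pochhammer cnorm_prod -(big_mkord xpredT (fun i => cnorm (z + i%:R))).
  rewrite (@big_cat_nat _ _ _ n) //=.
  apply: ler_pM; try by apply: prodr_ge0 => i _; apply: cnorm_ge0.
    have -> : (q%:R + n%:R : R) ^+ n = \prod_(0 <= i < n) (q%:R + n%:R).
      by rewrite prodr_const_nat subn0.
    rewrite !big_nat; apply: ler_prod => i /andP[_ iltn]; rewrite cnorm_ge0 /=.
    apply: le_trans (cnormD _ _) _; rewrite cnorm_nat lerD // ler_nat; exact: ltnW.
  apply: le_trans (prod_shift_le zq qn nm) _.
  rewrite ler_wpM2l ?(ltW H0) // ler_expR ler_wpM2l ?sqr_ge0 // gerBl invr_ge0.
  have : q%:R + 2 <= m%:R :> R by rewrite -natrD ler_nat; lia.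
  by lra.
have Rm := Re_gt0 m nm.
have f0 : 0 <= m`!%:R / (H * (complex.Re z + m%:R)) by rewrite divr_ge0 // mulr_ge0 // ltW.
apply: le_trans (ler_wpM2r f0 P) _.
have -> : (q%:R + n%:R) ^+ n * (H * K) * (m`!%:R / (H * (complex.Re z + m%:R))) =
  (q%:R + n%:R) ^+ n * K * m`!%:R * (complex.Re z + m%:R)^-1.
  by field; rewrite !gt_eqF.
have -> : (q%:R + n%:R) ^+ n * K * 2 * (m`!%:R / m%:R) =
  (q%:R + n%:R) ^+ n * K * m`!%:R * (2 / m%:R) by ring.
rewrite ler_wpM2l ?mulr_ge0 ?expR_ge0 ?exprn_ge0 //.
rewrite -[leLHS]mul1r ler_pdivrMr // mulrAC ler_pdivlMr // mul1r.
have : 2 * q%:R <= m%:R :> R by rewrite -natrM ler_nat; lia.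
by lra.
Qed.

End Pochhammer.

(** * Bounds off the poles, then passage to the limits *)

(** The moduli of [P * u A j z], with [P] a partial product of [alpha], satisfy the recurrence
    inequality with constants free of [k], which permits [k -> oo] later. *)
Lemma regular_bound (R : realType) (b : nat) (hb : (1 < b)%N) (A : {set 'I_b})
    (hA : exists2 a : 'I_b, a \in A & nat_of_ord a != 0%N) (q : nat) :
  exists (M : R) (n : nat), [/\ 0 <= M, (0 < n)%N &
    forall (z : Cpx R) m k, cnorm z <= q%:R -> regular A z ->
      (n <= m)%N -> (n <= k)%N ->
      cnorm (pochhammer z m / m`!%:R * (\prod_(0 <= i < k) factor A z i * u A m z))
        <= M * lambda R A ^+ m * m%:R^-1].
Proof.
(* Above every threshold required, and positive also for [q = 0]. *)
pose n := (4 * b * q.+1)%N.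
have qn : (4 * b * q <= n)%N by rewrite /n leq_mul.
have qn2 : (q.+2 <= n)%N by rewrite /n; nia.
have qn3 : (2 * q <= n)%N by rewrite /n; nia.
have l0 : 0 < lambda R A := lambda_gt0 R hb hA.
have [C [C0 low]] := low_moment_bound R hb A q n.
have K0 : 0 <= factor_bound R A q by apply: expR_ge0.
have CK0 : 0 <= C * factor_bound R A q by apply: mulr_ge0.
have [M1 [M10 rec]] := recurrence_bound hb hA CK0 qn qn2.
have [M2 [M20 poch]] := pochhammer_weight_le R qn2 qn3.
exists (M1 * M2), n; split; [exact: mulr_ge0 | lia |].
move=> z m k zq zr nm nk.
pose P := \prod_(0 <= i < k) factor A z i.
pose U j := cnorm (P * u A j z).
have zR := le_trans (Re_le_cnorm z) zq.
have Ulow j : (j < n)%N -> U j <= C * factor_bound R A q.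
  move=> jn; rewrite /U /P (@big_cat_nat _ _ _ j.+1) //=; last by lia.
  rewrite mulrAC cnormM ler_pM ?cnorm_ge0 ?cnorm_prod_factor_le //.
  by apply: low => //; lia.
have Urec j : (n <= j)%N -> (b%:R `^ (complex.Re z + j%:R) - #|A|%:R) * U j <=
    \sum_(0 <= i < j) 'C(j, i)%:R * (gamma A (j - i))%:R * U i.
  move=> nj; have j0 : (0 < j)%N by lia.
  apply: (@le_trans _ _ (cnorm (rpowC b%:R (z + j%:R) - #|A|%:R) * U j)).
    rewrite ler_wpM2r ?cnorm_ge0 //.
    by apply: le_trans (cnormB _ _); rewrite cnorm_rpowC ReD_nat cnorm_nat.
  rewrite /U -cnormM mulrCA u_rec // mulr_sumr.
  apply: le_trans (cnorm_sum _ _ _) _.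
  (* Reversing the sum over [1..j] gives one over [0..j-1], with [gamma] at [j - i]. *)
  rewrite big_add1 big_mkord big_rev_mkord subn0.
  rewrite le_eqVlt; apply/orP; left; apply/eqP; apply: eq_bigr => i _.
  have ij := ltn_ord i.
  by rewrite mulrCA !cnormM !cnorm_nat subKn // bin_sub.
have Um := rec _ U zR Ulow Urec m nm.
have m0 : 0 < m`!%:R :> R by rewrite ltr0n fact_gt0.
rewrite [leLHS]cnormM [cnorm (_ / _)]cnormM cnormV cnorm_nat -/P -/(U m).
apply: (@le_trans _ _ (cnorm (pochhammer z m) / m`!%:R *
   (M1 * (lambda R A ^+ m * weight (complex.Re z) n m)))).
  by rewrite ler_wpM2l // divr_ge0 ?cnorm_ge0.
have -> : cnorm (pochhammer z m) / m`!%:R *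
    (M1 * (lambda R A ^+ m * weight (complex.Re z) n m)) =
  M1 * lambda R A ^+ m / m`!%:R *
   (cnorm (pochhammer z m) * weight (complex.Re z) n m).
  by move: (weight _ _ _) (lambda R A) => w l; ring.
have c0 : 0 <= M1 * lambda R A ^+ m / m`!%:R.
  by rewrite divr_ge0 // mulr_ge0 // exprn_ge0 // ltW.
apply: le_trans (ler_wpM2l c0 (poch z m zq nm)) _.
rewrite le_eqVlt; apply/orP; left; apply/eqP.
have m1 : 0 < m%:R :> R by rewrite ltr0n; lia.
by move: (lambda R A) => l; field; rewrite !gt_eqF.
Qed.

(* Where a limit does not exist, [lim] is [point], which is 0 in [Cpx R]; the
   bound holds there too. *)
Lemma lim_mul_le (R : realType) (T : Type) (F : set_system T)
    (FF : ProperFilter F) (g f : T -> Cpx R) (l : Cpx R) (c : R) :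
  g x @[x --> F] --> l -> (\forall x \near F, cnorm (g x * f x) <= c) ->
  cnorm (l * lim (f x @[x --> F])) <= c.
Proof.
move=> gl gfc.
have c0 : 0 <= c.
  by have [x] := filter_ex gfc; apply: le_trans; apply: cnorm_ge0.
have [fl|nfl] := pselect (cvg (f x @[x --> F])); last first.
  by rewrite (dvgP nfl) -[point]/(0 : Cpx R) mulr0 -[0]/(0%:R) cnorm_nat.
set L := l * _; have gfL : g x * f x @[x --> F] --> L by exact: (cvgM gl fl).
rewrite leNgt; apply/negP => cL.
have e0 : 0 < (cnorm L - c)%:C :> Cpx R by rewrite ltcR subr_gt0.
have near_L : \forall x \near F, `|L - g x * f x| < (cnorm L - c)%:C.
  exact: (cvgr_dist_lt (fun x => g x * f x) L gfL _ e0).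
have [x [/= xc]] := filter_ex (filterI gfc near_L).
rewrite cnormE ltcR => xL.
by have := cnormB L (g x * f x); move: xc xL => /=; lra.
Qed.

Lemma compact_cnorm_le (R : realType) (Q : set (Cpx R)) : compact Q ->
  exists q : nat, forall s, Q s -> cnorm s <= q%:R.
Proof.
rewrite compact_cover => /(_ nat setT (fun n => ball (0 : Cpx R) n%:R)) [||D _ QD].
- by move=> n _; apply: ball_open.
- move=> s _; have [n sn] : exists n : nat, cnorm s < n%:R.
    by exists (Num.bound (cnorm s)); apply: archi_boundP; apply: cnorm_ge0.
  exists n => //; rewrite -ball_normE /= sub0r normrN cnormE.
  by rewrite -(rmorph_nat (real_complex R)) ltcR.
exists (\max_(n <- finmap.enum_fset D) n)%N => s /QD[n /= nD].
rewrite -ball_normE /= sub0r normrN cnormE -(rmorph_nat (real_complex R)) ltcR.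
by move=> /ltW /le_trans; apply; rewrite ler_nat; apply: leq_bigmax_seq.
Qed.

Lemma pochhammer_cvg (R : realType) (s : Cpx R) m :
  pochhammer z m @[z --> s^'] --> pochhammer s m.
Proof.
have id_cvg : (z : Cpx R) @[z --> s^'] --> s by apply: nbhs_dnbhs.
rewrite /pochhammer; elim: m => [|m IH].
  rewrite big_ord0; under eq_fun do rewrite big_ord0; exact: cvg_cst.
rewrite big_ord_recr /=; under eq_fun do rewrite big_ord_recr /=.
exact: (cvgM IH (cvgD id_cvg (cvg_cst _))).
Qed.

(** [alpha] is a limit of partial products, and the bound holds for all long ones: by
    [regular_bound], or because they vanish. *)
Lemma alpha_bound (R : realType) (b : nat) (hb : (1 < b)%N) (A : {set 'I_b})
    (hA : exists2 a : 'I_b, a \in A & nat_of_ord a != 0%N) (q : nat) :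
  exists (M : R) (n : nat), (0 < n)%N /\
    forall (z : Cpx R) m, cnorm z <= q%:R -> (n <= m)%N ->
      cnorm (pochhammer z m / m`!%:R * (alpha A z * u A m z))
        <= M * lambda R A ^+ m * m%:R^-1.
Proof.
have [M [n [M0 n0 H]]] := regular_bound R hb hA q.
exists M, n; split=> // z m zq nm.
rewrite [alpha A z * _]mulrC mulrA; apply: lim_mul_le; first exact: cvg_cst.
have [zr|] := pselect (regular A z).
  near=> k; rewrite -mulrA [u A m z * _]mulrC; apply: H => //.
  by near: k; apply: nbhs_infty_ge.
(* Here [b^(z + j) = N]: factor [j] of [alpha] is 0, and so is every longer partial product,
   whatever value the division by zero gives to [u]. *)
move=> /existsNP[j /negP/negPn/eqP zj].
have fj : 1 - rpowC b%:R (- z - j%:R) * #|A|%:R = 0 :> Cpx R.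
  by rewrite -zj -opprD mulrC rpowCN ?subrr // b_gt0.
near=> k; have jk : (j < k)%N by near: k; apply: nbhs_infty_gt.
rewrite (_ : \prod_(0 <= i < k) _ = 0); last first.
  apply/eqP; rewrite prodf_seq_eq0; apply/hasP; exists j.
    by rewrite mem_index_iota.
  by rewrite fj eqxx.
rewrite mulr0 -[0]/(0%:R) cnorm_nat mulr_ge0 ?invr_ge0 // mulr_ge0 //.
by rewrite exprn_ge0 // ltW // lambda_gt0.
Unshelve. all: by end_near. Qed.

Theorem theorem2p3 (R : realType) (b : nat) (hb : (1 < b)%N) (A : {set 'I_b})
    (hA : exists2 a : 'I_b, a \in A & nat_of_ord a != 0%N)
    (Q : set (Cpx R)) (hQ : compact Q) :
  exists (M : R) (m0 : nat), (1 <= m0)%N /\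
    forall (s : Cpx R) (m : nat), Q s -> (m0 <= m)%N ->
      `| pochhammer s m / (m`!)%:R * alpha_u A m s |
        <= (M * lambda R A ^+ m * m%:R^-1)%:C.
Proof.
have [q Qq] := compact_cnorm_le hQ.
(* Radius [q + 1]: the limit defining [alpha_u] is taken through points within distance 1 of [s]. *)
have [M [n [n0 H]]] := alpha_bound R hb hA q.+1.
exists M, n; split=> // s m /Qq sq nm; rewrite cnorm_le.
apply: (@lim_mul_le _ _ _ _ (fun z => pochhammer z m / m`!%:R)).
  exact: (cvgM (@pochhammer_cvg _ s m) (cvg_cst _)).
have near_s : \forall z \near s^', ball s 1 z.
  by apply: nbhs_dnbhs; apply: nbhsx_ballx.
near=> z; apply: H => //.
have : ball s 1 z by near: z.
rewrite -ball_normE /= cnormE -[1]/(1%:C) ltcR => sz.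
have := cnormB z s; rewrite -[cnorm (z - s)]cnormN opprB -natr1; move: sz sq; lra.
Unshelve. all: by end_near. Qed.
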